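(* Let $\mathcal A$ be countably infinite and let $\Sigma_{\mathcal A}$ be the OTW full shift over $\mathcal A$ with the shift map $\sigma$. For every OTW metric $d_{\mathcal P}$ (i.e. for every enumeration $\mathcal P$ of $\Sigma_{\mathcal A}^{\mathrm{fin}}$), the system $(\Sigma_{\mathcal A},\sigma,d_{\mathcal P})$ has the shadowing property.
   Context: Let $\Sigma_{\mathcal A}^{\mathrm{fin}}:=\{\tilde 0\}\cup\bigcup_{k\ge1}\mathcal A^k$ be the set of finite words over $\mathcal A$, where $\tilde 0$ is the empty word, and $\mathcal A^{\mathbb N}=\{x_1x_2\cdots:\ x_i\in\mathcal A\}$ the set of infinite words. The OTW full shift is the disjoint union $\Sigma_{\mathcal A}:=\mathcal A^{\mathbb N}\sqcup\Sigma_{\mathcal A}^{\mathrm{fin}}$; $|x|\in\{0,1,2,\dots,\infty\}$ denotes length. For $u\in\Sigma_{\mathcal A}^{\mathrm{fin}}$ and $x\in\Sigma_{\mathcal A}$, write $u\preceq x$ ($u$ is a prefix of $x$) if either $u=\tilde 0$, or $u=u_1\cdots u_k$ with $k\ge1$, $|x|\ge k$ and $x_1\cdots x_k=u_1\cdots u_k$. An enumeration of $\Sigma_{\mathcal A}^{\mathrm{fin}}$ is a listing $p_1,p_2,\dots$ in which each finite word appears exactly once. Given an enumeration $\mathcal P=\{p_1,p_2,\dots\}$, the associated OTW metric is defined by $d_{\mathcal P}(x,x)=0$ and, for $x\ne y$, $d_{\mathcal P}(x,y)=2^{-i}$ where $i=\min\{j\ge1:\ \text{exactly one of } p_j\preceq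 x,\ p_j\preceq y \text{ holds}\}$. The shift map is regarded as a partially defined map (local homeomorphism) with domain $\mathrm{Dom}(\sigma)=\Sigma_{\mathcal A}\setminus\{\tilde 0\}$ (the elements of length at least $1$): $\sigma(x_1x_2x_3\cdots)=x_2x_3\cdots$, $\sigma(x_1\cdots x_k)=x_2\cdots x_k$ for $k\ge2$, and $\sigma(x_1)=\tilde 0$. Inductively $\mathrm{Dom}(\sigma^n)=\sigma^{-1}(\mathrm{Dom}(\sigma^{n-1}))$, so $\mathrm{Dom}(\sigma^n)=\{x:|x|\ge n\}$. For a metric $d$ on $\Sigma_{\mathcal A}$ and $\delta>0$, a sequence $(x^n)_{n\ge 0}$ in $\Sigma_{\mathcal A}$ is a $\delta$-pseudo-orbit if $x^n\in\mathrm{Dom}(\sigma)$ and $d(\sigma(x^n),x^{n+1})<\delta$ for all $n\ge0$. A point $x$ $\varepsilon$-shadows $(x^n)_{n\ge0}$ if $x\in\mathrm{Dom}(\sigma^i)$ and $d(\sigma^i(x),x^i)<\varepsilon$ for all $i\ge0$. The shadowing property: for every $\varepsilon>0$ there exists $\delta>0$ such that every $\delta$-pseudo-orbit is $\varepsilon$-shadowed by some point of $\Sigma_{\mathcal A}$. *)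

(* Defs.v *)
From mathcomp Require Import all_boot all_order all_algebra.
From mathcomp Require Import boolp classical_sets functions cardinality reals.

Set Implicit Arguments.
Unset Strict Implicit.
Unset Printing Implicit Defensive.

Import Order.TTheory GRing.Theory Num.Theory.
Local Open Scope ring_scope.

(* Letters are indexed from 0: the letter x_(i+1) of an infinite word [f] is
   [f i]. The empty word is [Finite [::]]. *)
Inductive otw_shift (A : Type) : Type :=
  | Infinite of nat -> A
  | Finite of seq A.

Definition is_prefix (A : Type) (u : seq A) (x : otw_shift A) : Prop :=
  match x with
  | Infinite f => mkseq f (size u) = u
  | Finite w => (size u <= size w)%N /\ take (size u) w = u
  end.

Definition separates (A : Type) (p : seq A) (x y : otw_shift A) : bool :=
  `[< is_prefix p x >] (+) `[< is_prefix p y >].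

(* The least [j] such that [P j] separates [x] and [y]. The default value 0 is
   never used when [P] is bijective and [x <> y], by [ex_separates] below. *)
Definition first_separator (A : Type) (P : nat -> seq A) (x y : otw_shift A) :
    nat :=
  match pselect (exists j, separates (P j) x y) with
  | left exj => ex_minn exj
  | right _ => 0%N
  end.

(* The word p_j of a listing p_1, p_2, ... is [P j.-1], so that the exponent is
   the successor of the least separating index. *)
Definition otw_dist (R : realType) (A : Type) (P : nat -> seq A)
    (x y : otw_shift A) : R :=
  if `[< x = y >] then 0 else 2^-1 ^+ (first_separator P x y).+1.

(* [None] encodes being outside the domain of the partial map. *)
Definition shift (A : Type) (x : otw_shift A) : option (otw_shift A) :=
  match x with
  | Infinite f => Some (Infinite (fun i => f i.+1))
  | Finite [::] => None
  | Finite (_ :: w) => Some (Finite w)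
  end.

Fixpoint shift_iter (A : Type) (n : nat) (x : otw_shift A) :
    option (otw_shift A) :=
  if n is m.+1 then obind (@shift_iter A m) (shift x) else Some x.

Definition pseudo_orbit (R : realType) (A : Type)
    (d : otw_shift A -> otw_shift A -> R) (delta : R)
    (xs : nat -> otw_shift A) : Prop :=
  forall n, exists2 y, shift (xs n) = Some y & d y (xs n.+1) < delta.

Definition shadows (R : realType) (A : Type)
    (d : otw_shift A -> otw_shift A -> R) (eps : R)
    (x : otw_shift A) (xs : nat -> otw_shift A) : Prop :=
  forall i, exists2 y, shift_iter i x = Some y & d y (xs i) < eps.

Definition shadowing_property (R : realType) (A : Type)
    (d : otw_shift A -> otw_shift A -> R) : Prop :=
  forall eps : R, 0 < eps -> exists2 delta : R, 0 < delta &
    forall xs : nat -> otw_shift A, pseudo_orbit d delta xs ->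
      exists x : otw_shift A, shadows d eps x xs.

Lemma is_prefix_self (A : Type) (w : seq A) : is_prefix w (Finite w).
Proof. by split; rewrite ?take_size. Qed.

Lemma is_prefix_mkseq (A : Type) (f : nat -> A) n :
  is_prefix (mkseq f n) (Infinite f).
Proof. by rewrite /= size_mkseq. Qed.

Lemma eq_otw_shift (A : Type) (x y : otw_shift A) :
  (forall u, is_prefix u x <-> is_prefix u y) -> x = y.
Proof.
have pf f n w : is_prefix (mkseq f n) (Finite w) -> (n <= size w)%N.
  by move=> [+ _]; rewrite size_mkseq.
case: x y => [f|v] [g|w] H.
- congr Infinite; apply/funext => i.
  have /H := is_prefix_mkseq f i.+1.
  rewrite /is_prefix size_mkseq => /(congr1 (nth (f i) ^~ i)).
  by rewrite !nth_mkseq.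
- by have /H/pf := is_prefix_mkseq f (size w).+1; rewrite ltnn.
- by have /H/pf := is_prefix_mkseq g (size v).+1; rewrite ltnn.
- have /H [le_vw vE] := is_prefix_self v.
  have /H [le_wv _] := is_prefix_self w.
  by rewrite -vE take_oversize.
Qed.

Lemma ex_separates (A : Type) (P : nat -> seq A) (x y : otw_shift A) :
  bijective P -> x <> y -> exists j, separates (P j) x y.
Proof.
move=> [Q _ QK] neq_xy; apply: contrapT => nsep; apply: neq_xy.
apply: eq_otw_shift => u; rewrite -[u]QK.
have /negP : ~ separates (P (Q u)) x y by move=> s; apply: nsep; exists (Q u).
rewrite /separates negb_add => /eqP eq_pfx.
by split=> /asboolP; [rewrite eq_pfx|rewrite -eq_pfx] => /asboolP.
Qed.

(* Main.v *)
Require Import Defs.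
From mathcomp Require Import all_boot all_order all_algebra.
From mathcomp Require Import boolp classical_sets functions cardinality reals.

(** Closeness in the OTW metric means having the same prefixes among finitely
    many words: [otw_dist P x y] is below [2^-N] as soon as the words [P j],
    [j < N], do not tell [x] from [y], and conversely a distance below [2^-M]
    forces this for all [j < M] ([otw_dist_lt], [otw_dist_ltP]).

    Every point of a pseudo-orbit is nonempty, because the shift must be defined
    at it. The shadowing point is therefore the infinite word whose [i]-th letter
    is the first letter of the [i]-th point of the pseudo-orbit. Given [eps],
    let [N] be such that [2^-N < eps], and let [delta] be so small that the
    shift of each point and the next point have the same prefixes among all
    suffixes of [P j], [j < N], which are finitely many words. A word [a :: u]
    is a prefix of a point iff [a] is the first letter and [u] is a prefix of
    the shifted point; if [u] is one of these suffixes, then [u] may be tested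
    on the next point instead. Since the set of suffixes is closed under
    removing the first letter, induction on the length shows that its elements
    are prefixes of the [i]-th point iff they are prefixes of the word of first
    letters read from position [i] ([trace_prefix]). *)

Set Implicit Arguments.
Unset Strict Implicit.
Unset Printing Implicit Defensive.

Import Order.TTheory GRing.Theory Num.Theory.
Local Open Scope ring_scope.

Definition otw_cons (A : Type) (a : A) (x : otw_shift A) : otw_shift A :=
  match x with
  | Infinite f => Infinite (fun i => if i is k.+1 then f k else a)
  | Defs.Finite w => Defs.Finite (a :: w)
  end.

Lemma shift_otw_cons (A : Type) (x y : otw_shift A) :
  shift x = Some y -> exists a, x = otw_cons a y.
Proof.
case: x => [f|[|a w]] //= [<-]; last by exists a.
by exists (f 0%N); congr Infinite; apply/funext => -[].
Qed.

Lemma Infinite_otw_cons (A : Type) (f : nat -> A) :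
  Infinite f = otw_cons (f 0%N) (Infinite (fun k => f k.+1)).
Proof. by congr Infinite; apply/funext => -[]. Qed.

Lemma is_prefix_nil (A : Type) (x : otw_shift A) : is_prefix [::] x.
Proof. by case: x => //= w; rewrite take0. Qed.

Lemma is_prefix_cons (A : Type) (a b : A) (u : seq A) (x : otw_shift A) :
  is_prefix (a :: u) (otw_cons b x) <-> a = b /\ is_prefix u x.
Proof.
case: x => [f|w] /=.
  rewrite /mkseq /= -[1%N]/(1 + 0)%N iotaDl -map_comp.
  by split=> [[-> uE]|[-> uE]]; [split|congr cons].
by split=> [[le_uw [-> ->]]|[-> [le_uw ->]]].
Qed.

Lemma shift_iter_Infinite (A : Type) (i : nat) (f : nat -> A) :
  shift_iter i (Infinite f) = Some (Infinite (fun k => f (i + k)%N)).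
Proof. by elim: i f => [|i IHi] f //=; rewrite IHi. Qed.

(** Closure of [G] under removing the first letter is what makes the induction
    on the length work: the tail of a word is tested one step later along the
    sequence, where the comparison of [y i] with [xs i.+1] applies to it. *)
Lemma trace_prefix (A : Type) (G : seq A -> Prop)
    (xs y : nat -> otw_shift A) (f : nat -> A) :
    (forall a u, G (a :: u) -> G u) ->
    (forall i, xs i = otw_cons (f i) (y i)) ->
    (forall i u, G u -> is_prefix u (y i) <-> is_prefix u (xs i.+1)) ->
  forall u i, G u ->
    is_prefix u (Infinite (fun k => f (i + k)%N)) <-> is_prefix u (xs i).
Proof.
move=> Gtail xsE yxs; elim=> [|a u IHu] i Gu.
  by split=> _; apply: is_prefix_nil.
have Gu' := Gtail _ _ Gu.
rewrite Infinite_otw_cons xsE !is_prefix_cons addn0 yxs // -IHu //.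
by under eq_fun do rewrite addnS -addSn.
Qed.

Lemma separatesPn (A : Type) (p : seq A) (x y : otw_shift A) :
  ~~ separates p x y <-> (is_prefix p x <-> is_prefix p y).
Proof.
rewrite /separates negb_add; split=> [/eqP pE|pE].
  exact: asbool_eq_equiv.
by apply/eqP; apply: asbool_equiv_eq.
Qed.

Section OtwDist.
Variables (R : realType) (A : Type) (P : nat -> seq A).
Hypothesis P_enum : bijective P.
Implicit Types x y : otw_shift A.

Lemma first_separatorP x y : x <> y ->
  separates (P (first_separator P x y)) x y /\
  (forall j, separates (P j) x y -> (first_separator P x y <= j)%N).
Proof.
move=> /(ex_separates P_enum) exj; rewrite /first_separator.
by case: pselect => // exj'; case: ex_minnP.
Qed.

Lemma otw_dist_lt N x y :
    (forall j, (j < N)%N -> is_prefix (P j) x <-> is_prefix (P j) y) ->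
  otw_dist R P x y < 2^-1 ^+ N.
Proof.
move=> agree; rewrite /otw_dist; case: asboolP => [_|/first_separatorP[sep _]].
  by rewrite exprn_gt0 ?invr_gt0 ?ltr0n.
have [/agree/separatesPn|leN] := ltnP (first_separator P x y) N.
  by rewrite sep.
by rewrite ltr_iXn2l ?invr_gt0 ?ltr0n ?invf_lt1 ?ltr1n.
Qed.

Lemma otw_dist_ltP M x y : otw_dist R P x y < 2^-1 ^+ M ->
  forall j, (j < M)%N -> is_prefix (P j) x <-> is_prefix (P j) y.
Proof.
rewrite /otw_dist; case: asboolP => [-> //|/first_separatorP[_ minsep]] + j ltjM.
rewrite ltr_iXn2l ?invr_gt0 ?ltr0n ?invf_lt1 ?ltr1n // ltnS => leM.
apply/separatesPn/negP => /minsep lej.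
by have := leq_ltn_trans lej (leq_trans ltjM leM); rewrite ltnn.
Qed.

End OtwDist.

Lemma exists_half_pow_lt (R : realType) (eps : R) :
  0 < eps -> exists N, 2^-1 ^+ N < eps.
Proof.
move=> eps_gt0; exists (Num.bound eps^-1).
rewrite exprVn -[ltRHS]invrK ltf_pV2 ?posrE ?invr_gt0 ?exprn_gt0 ?ltr0n //.
exact: upper_nthrootP.
Qed.

Lemma suffix_index_bound (A : Type) (P : nat -> seq A) (N : nat) :
    bijective P ->
  exists M, forall j k, (j < N)%N ->
    exists2 i, (i < M)%N & P i = drop k (P j).
Proof.
move=> [Q _ QK].
pose B j := \max_(k < (size (P j)).+1) Q (drop k (P j)).
exists (\max_(j < N) B j).+1 => j k ltjN; exists (Q (drop k (P j))) => //.
(* Dropping more letters than there are gives the empty suffix again. *)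
have -> : drop k (P j) = drop (minn k (size (P j))) (P j).
  by case: leqP => // /ltnW le; rewrite drop_size drop_oversize.
have ltk : (minn k (size (P j)) < (size (P j)).+1)%N by rewrite ltnS geq_minr.
rewrite ltnS; apply: leq_trans (leq_bigmax (Ordinal ltjN)).
exact: (leq_bigmax (F := fun k : 'I__ => Q (drop k (P j))) (Ordinal ltk)).
Qed.

Theorem proposition5p2 (R : realType) (A : Type)
    (A_countable : countable [set: A]%classic)
    (A_infinite : infinite_set [set: A]%classic)
    (P : nat -> seq A) (P_enum : bijective P) :
  shadowing_property (@otw_dist R A P).
Proof.
move=> eps /exists_half_pow_lt[N ltNeps].
have [M sufM] := suffix_index_bound N P_enum.
exists (2^-1 ^+ M) => [|xs po]; first by rewrite exprn_gt0 ?invr_gt0 ?ltr0n.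
have /choice[ay ayP] : forall n, exists ay : A * otw_shift A,
    xs n = otw_cons ay.1 ay.2 /\ otw_dist R P ay.2 (xs n.+1) < 2^-1 ^+ M.
  by move=> n; have [y /shift_otw_cons[a xsE] dy] := po n; exists (a, y).
pose G u := exists j k, (j < N)%N /\ u = drop k (P j).
have Gtail a u : G (a :: u) -> G u.
  move=> [j [k [ltjN uE]]]; exists j, k.+1; split=> //.
  by rewrite -add1n -drop_drop -uE /= drop0.
have agree i u : G u ->
    is_prefix u (ay i).2 <-> is_prefix u (xs i.+1).
  move=> [j [k [ltjN ->]]]; have [l ltlM <-] := sufM j k ltjN.
  exact: (otw_dist_ltP P_enum (ayP i).2).
exists (Infinite (fun i => (ay i).1)) => i.
rewrite shift_iter_Infinite; eexists; first by [].
apply: lt_trans ltNeps; apply: otw_dist_lt => // j ltjN.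
apply: (trace_prefix Gtail (fun n => (ayP n).1) agree (f := fun n => (ay n).1)).
by exists j, 0%N; rewrite drop0.
Qed.
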